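(* Let $S\subseteq F_*$ be strictly non-expanding, let $\mathcal I$ be the two-sided ideal of $F_*$ generated by $S$, and let $A=F_*/\mathcal I$. Let $\phi$ be an enumeration of $BW$ and let $\xi$ be a sequence of positive numbers for which the form $\langle\cdot,\cdot\rangle_\xi$ (defined in the context) is positive definite, so that, identifying $A$ with $K$, $(K,\langle\cdot,\cdot\rangle_\xi)$ is a pre-Hilbert space. Then the right regular representation $L$ of the $*$-algebra $A$ on $(K,\langle\cdot,\cdot\rangle_\xi)$, $L_z(f)=fz$ for $z,f\in A$, is a faithful $*$-representation; that is, $\langle L_z f,g\rangle_\xi=\langle f,L_{z^*}g\rangle_\xi$ for all $z,f,g\in A$, and $L_z=0$ only if $z=0$.
   Context: Words and order. $F_*=\mathbb{C}\langle x_1,\dots,x_m,x_1^*,\dots,x_m^*\rangle$ is the free associative algebra with involution given on generators by $x_j\mapsto x_j^*$; $W$ is the semigroup of all words (including the empty word) in the $2m$ generators, and $|w|$ is the length of $w$. A linear order on the generators is fixed, and words are ordered degree-lexicographically: longer words are greater, words of the same length are compared lexicographically. For words, $\sup(u,v)$ is the greater of $u,v$. For $f=\sum_{w\in W}f(w)w\in F_*$ and $z\in W$ write $z\prec f$ iff $f(z)\neq0$. For $f\ne0$, $\hat f$ is the greatest word $w$ with $w\prec f$, and $\deg f=|\hat f|$. Compositions. $f,g\in F_*$ form a composition $w\in W$ if $w=\hat f w_1=w_2\hat g$ for nonempty words $w_1,w_2$ with $|\hat f|>|w_2|$; its result is $(f,g)_w=\beta f w_1-\alpha w_2 g$, where $\alpha,\beta$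 are the coefficients of $\hat f,\hat g$ in $f,g$. A subset $S\subseteq F_*$ is closed under compositions if for all $f,g\in S$: (1) if $f\ne g$, then $\hat f$ is not a subword of $\hat g$; (2) if $f,g$ form a composition $w$, then $(f,g)_w=\sum_{j}\alpha_j a_jf_jb_j$ (finite sum) with $\alpha_j\in\mathbb{C}$, $a_j,b_j\in W$, $f_j\in S$, and the greatest word of each $a_jf_jb_j$ is less than $w$. For such $S$, let $\mathcal I$ be the two-sided ideal generated by $S$ and $BW$ the set of words containing no $\hat s$ ($s\in S$) as a subword. The images of $BW$ form a linear basis of $F_*/\mathcal I$. Let $K$ be the linear span of $BW$ and let $\mathrm R_S:F_*\to K$ be the linear map sending $f$ to the unique element of $K$ congruent to $f$ modulo $\mathcal I$. With the product $f\diamond g=\mathrm R_S(fg)$, $K$ is an algebra isomorphic to $A=F_*/\mathcal I$, and $A$ is identified with $K$ in this way. Non-expanding sets. $S\subseteq F_*$ is symmetric if the ideal $\mathcal I$ generated by $S$ is closed under the involution (so that $A$ is a $*$-algebra). A symmetric $S$ closed under compositions is non-expanding if for all $u,v,w\in BW$ with $u\neq v$ and $ww^*\prec \mathrm R_S(uv^* )$ one has $w<\sup(u,v)$; it is strictly non-expanding if in addition $dd^*\in BW$ for every $d\in BW$. The form. An enumeration of $BW$ is a bijection $\phi$ of $BW$ onto $\mathbb{N}=\{1,2,\dots\}$ if $BW$ is infinite, or onto $\{1,\dots,|BW|\}$ if $BW$ is finite, such that $u>v$ implies $\phi(u)>\phi(v)$. Let $\mathrm H:F_*\to F_*$ be the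 linear map with $\mathrm H(uu^* )=u$ for $u\in W$ and $\mathrm H(v)=0$ for words $v$ not of the form $uu^*$. For a sequence $\xi=\{a_k\}_{k\in\mathbb{N}}$ of positive reals, let $T_\xi^\phi:K\to\mathbb{C}$ be the linear functional with $T_\xi^\phi(u)=a_{\phi(u)}$ for $u\in BW$. The form $\langle\cdot,\cdot\rangle_\xi$ on $K$ is linear in the first argument and conjugate-linear in the second, with $\langle u,u\rangle_\xi=a_{\phi(u)}$ for $u\in BW$ and $\langle u,v\rangle_\xi=T_\xi^\phi(\mathrm H(\mathrm R_S(uv^* )))$ for distinct $u,v\in BW$. Convention. The right regular representation is the action of $A$ on itself by right multiplication; operators are composed in the order of a right action, i.e. $L_{zw}$ is $L_z$ followed by $L_w$. *)

(* Defs.v *)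
From HB Require Import structures.
From mathcomp Require Import all_boot all_order all_algebra.
From mathcomp Require Import finmap.
From mathcomp Require Import boolp classical_sets functions cardinality reals.
From mathcomp Require Import complex.
From mathcomp Require Import monalg.

Set Implicit Arguments.
Unset Strict Implicit.
Unset Printing Implicit Defensive.

Import Order.TTheory GRing.Theory Num.Theory.

Local Open Scope classical_set_scope.
Local Open Scope card_scope.
Local Open Scope ring_scope.

(* (j, false) is the generator x_j and (j, true) is x_j^*. *)
Definition gen (m : nat) : choiceType := ('I_m * bool)%type.

Definition word (m : nat) := {fmonom (gen m)}.

Definition freealg (R : realType) (m : nat) := {malg R[i][word m]}.

Definition gstar (m : nat) (x : gen m) : gen m := (x.1, ~~ x.2).

Definition wstar (m : nat) (w : word m) : word m :=
  FMonom (rev (map (@gstar m) w)).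

Section Algebra.
Variables (R : realType) (m : nat).

Local Notation F := (freealg R m).
Local Notation W := (word m).
Implicit Types (f g z : F) (u v w : W) (S : set F).

(* The involution is conjugate-linear. *)
Definition star f : F :=
  \sum_(w <- msupp f) << conjc f@_w *g wstar w >>.

Definition two_sided_ideal (I : set F) : Prop :=
  [/\ I 0,
      forall f g, I f -> I g -> I (f + g),
      forall z f, I f -> I (z * f)
    & forall f z, I f -> I (f * z)].

Definition ideal_gen S : set F := smallest two_sided_ideal S.

Definition symmetric_set S : Prop :=
  forall f, ideal_gen S f -> ideal_gen S (star f).

(* A word is of the form u u^* for at most one u, namely its first half. *)
Definition Hword w : F :=
  let u : W := FMonom (take (fdeg w)./2 w) in
  if w == mmul u (wstar u) then << u >> else 0.

Definition Hmap f : F := \sum_(w <- msupp f) f@_w *: Hword w.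

(* Strict lexicographic comparison, used below on words of equal length. *)
Fixpoint lexlt (le : rel (gen m)) (s t : seq (gen m)) : bool :=
  match s, t with
  | x :: s', y :: t' => if x == y then lexlt le s' t' else le x y
  | _, _ => false
  end.

Section Order.
Variable le : rel (gen m).

Definition wlt u v : bool :=
  (fdeg u < fdeg v)%N || ((fdeg u == fdeg v) && lexlt le u v).

Definition wsup u v : W := if wlt u v then v else u.

(* The empty word is the least word, so this is the greatest word of f when
   f != 0; the value at f = 0 is never used. *)
Definition hat f : W := \big[wsup/mone]_(w <- msupp f) w.

Definition composes f g w w1 w2 : Prop :=
  [/\ w1 != mone, w2 != mone, w = mmul (hat f) w1, w = mmul w2 (hat g)
    & (fdeg w2 < fdeg (hat f))%N].

Definition composition f g w1 w2 : F :=
  g@_(hat g) *: (f * << w1 >>) - f@_(hat f) *: (<< w2 >> * g).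

(* As hat is meaningful on nonzero elements only, a possible element 0 of S is
   disregarded here and in BW. *)
Definition closed_compositions S : Prop :=
  (forall f g, S f -> S g -> f != 0 -> g != 0 -> f != g ->
     ~~ infix (hat f) (hat g)) /\
  (forall f g w w1 w2, S f -> S g -> f != 0 -> g != 0 ->
     composes f g w w1 w2 ->
     exists (n : nat) (c : 'I_n -> R[i]) (a b : 'I_n -> W) (h : 'I_n -> F),
       (forall j, [/\ S (h j), h j != 0
                    & wlt (hat (<< a j >> * h j * << b j >>)) w]) /\
       composition f g w1 w2
         = \sum_(j < n) c j *: (<< a j >> * h j * << b j >>)).

Definition BW S : set W :=
  [set w | forall s, S s -> s != 0 -> ~~ infix (hat s) w].

Definition spanBW S : set F := [set f | forall w, w \in msupp f -> BW S w].

(* For S closed under compositions there is exactly one such k. *)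
Definition reduce S f : F :=
  xget 0 [set k | spanBW S k /\ ideal_gen S (f - k)].

Definition nonexpanding S : Prop :=
  [/\ symmetric_set S, closed_compositions S
    & forall u v w, BW S u -> BW S v -> BW S w -> u != v ->
        mmul w (wstar w) \in msupp (reduce S << mmul u (wstar v) >>) ->
        wlt w (wsup u v)].

Definition strictly_nonexpanding S : Prop :=
  nonexpanding S /\ (forall d, BW S d -> BW S (mmul d (wstar d))).

Definition enumeration S (phi : W -> nat) : Prop :=
  [/\ infinite_set (BW S) -> set_bij (BW S) [set n | (1 <= n)%N] phi,
      forall N, BW S #= `I_N -> set_bij (BW S) [set n | (1 <= n <= N)%N] phi
    & forall u v, BW S u -> BW S v -> wlt v u -> (phi v < phi u)%N].

Definition Tfun (phi : W -> nat) (xi : nat -> R) f : R[i] :=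
  \sum_(u <- msupp f) f@_u * (xi (phi u))%:C%C.

Definition formxi_word S (phi : W -> nat) (xi : nat -> R) u v : R[i] :=
  if u == v then (xi (phi u))%:C%C
  else Tfun phi xi (Hmap (reduce S << mmul u (wstar v) >>)).

Definition formxi S (phi : W -> nat) (xi : nat -> R) f g : R[i] :=
  \sum_(u <- msupp f) \sum_(v <- msupp g)
    f@_u * conjc g@_v * formxi_word S phi xi u v.

Definition positive_definite S (B : F -> F -> R[i]) : Prop :=
  forall f, spanBW S f -> f != 0 -> 0 < B f f.

(* The quotient of the free algebra by ideal_gen S is identified with the
   space spanBW S, with the transported product and involution. *)
Definition diamond S f g : F := reduce S (f * g).

Definition quot_star S f : F := reduce S (star f).

Definition right_regular S z f : F := diamond S f z.

(* Operators are composed in the order of a right action. *)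
Definition star_representation S (B : F -> F -> R[i]) (L : F -> F -> F)
    : Prop :=
  let K := spanBW S in
  [/\ forall z f, K z -> K f -> K (L z f),
      forall z, K z -> forall (c : R[i]) f g, K f -> K g ->
        L z (c *: f + g) = c *: L z f + L z g,
      forall (c : R[i]) y z f, K y -> K z -> K f ->
        L (c *: y + z) f = c *: L y f + L z f,
      forall z y f, K z -> K y -> K f -> L (diamond S z y) f = L y (L z f)
    & forall z f g, K z -> K f -> K g ->
        B (L z f) g = B f (L (quot_star S z) g)].

Definition faithful S (L : F -> F -> F) : Prop :=
  forall z, spanBW S z -> (forall f, spanBW S f -> L z f = 0) -> z = 0.

End Order.
End Algebra.

(* Main.v *)
Require Import Defs.
From mathcomp Require Import all_boot all_order all_algebra.
From mathcomp Require Import finmap.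
From mathcomp Require Import boolp classical_sets reals.
From mathcomp Require Import complex monalg.

Set Implicit Arguments.
Unset Strict Implicit.
Unset Printing Implicit Defensive.

Import GRing.Theory.

Local Open Scope ring_scope.

(** The form is governed by one linear functional.  Let [R_S f] be the normal
    form of [f], let [H] and [T] be the linear maps of the definition of the
    form, and put [tau f = T (H (R_S f))].  For distinct [u], [v] in [BW],
    [<u, v> = tau (u v')] by definition, where [v'] is the adjoint of [v]; for
    [u = v] strictness makes [u u'] its own normal form, so that
    [tau (u u') = T u = <u, u>].  Hence [<f, g> = tau (f g')] for all [f], [g]
    in the span [K] of [BW] ([formxiE]).  As [tau] vanishes on the ideal, and
    the ideal is closed under the involution,
    [<f z, g> = tau (f z g') = tau (f (g z')') = <f, g z'>].
    Faithfulness holds because [L_z 1 = z], unless [BW] is empty and [K = 0].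

    This needs normal forms to exist and to be unique.  Existence
    ([normal_form_mon]) is the division algorithm, by induction along the
    degree-lexicographic order.  Uniqueness ([ideal_spanBW_eq0]) is the
    composition-diamond lemma: a nonzero element of the ideal has a word
    outside [BW].  Write such an element as a combination of products [a s b]
    with [s] in [S], and let [w] be the greatest of their greatest words.  Any
    two products with greatest word [w] are proportional up to products with
    smaller greatest words ([spoly_lt]): this is clear if the two occurrences
    of greatest words are disjoint in [w], it is closedness under compositions
    if they overlap, and one cannot contain the other unless they agree.  So a
    single product with greatest word [w] remains ([lead_span_top]); either it
    contributes the word [w], which is not in [BW], or it can be dropped and
    [w] decreases. *)

Local Notation "u ** v" := (mmul u v) (at level 40, left associativity).

(** * The degree-lexicographic order *)

Section DegLex.
Variables (m : nat) (le : rel (gen m)).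
Hypotheses (le_anti : antisymmetric le) (le_trans : transitive le).
Hypothesis (le_total : total le).

Implicit Types (x y : gen m) (r s t : seq (gen m)) (u v w a b : word m).

(** The number of letters smaller than [x]. *)
Definition letter_rank x : nat :=
  #|[pred y : 'I_m * bool | (y != x) && le y x]|.

(** Any number that exceeds all letter ranks and is at least 2 would do; the
    latter separates the ranks of words of different lengths. *)
Definition radix : nat := #|{: 'I_m * bool}|.+2.

(** The number with digits the letter ranks, first letter most significant. *)
Fixpoint code s : nat :=
  if s is x :: s' then (letter_rank x * radix ^ size s' + code s')%N else 0.

(** An embedding of words into the natural numbers: the leading digit 1 put
    before the digits of [w] makes longer words greater. *)
Definition rank w : nat := (radix ^ fdeg w + code w)%N.

Lemma letter_rank_lt_radix x : (letter_rank x < radix)%N.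
Proof. by rewrite /letter_rank /radix !ltnS; apply/leqW/max_card. Qed.

Lemma letter_rank_lt x y :
  x != y -> le x y -> (letter_rank x < letter_rank y)%N.
Proof.
move=> nxy lxy; apply: proper_card; apply/properP; split.
  apply/fintype.subsetP => z; rewrite !inE => /andP[nzx lzx].
  rewrite (le_trans lzx lxy) andbT; apply: contra nxy => /eqP zy.
  by apply/eqP/le_anti; rewrite lxy -zy lzx.
by exists x; rewrite !inE ?eqxx // nxy lxy.
Qed.

Lemma code_lt s : (code s < radix ^ size s)%N.
Proof.
elim: s => [//|x s IH] /=; rewrite expnS.
apply: (@leq_trans ((letter_rank x).+1 * radix ^ size s)); last first.
  by rewrite leq_mul2r letter_rank_lt_radix orbT.
by rewrite mulSnr ltn_add2l.
Qed.

Lemma lexlt_code s t :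
  size s = size t -> lexlt le s t -> (code s < code t)%N.
Proof.
elim: s t => [|x s IH] [|y t] //= [st]; case: eqVneq => [->|nxy].
  by move=> /(IH _ st); rewrite st ltn_add2l.
move=> /(letter_rank_lt nxy) lxy.
apply: (@leq_trans ((letter_rank x).+1 * radix ^ size t)).
  by rewrite mulSnr -st ltn_add2l code_lt.
by apply: (leq_trans _ (leq_addr _ _)); rewrite leq_mul2r lxy orbT.
Qed.

Lemma lexlt_total s t :
  size s = size t -> [\/ s = t, lexlt le s t | lexlt le t s].
Proof.
elim: s t => [|x s IH] [|y t] //=; first by constructor 1.
move=> [st]; rewrite (eq_sym y); case: eqVneq => [->|nxy].
  by case: (IH _ st) => [->|h|h]; [constructor 1|constructor 2|constructor 3].
by case/orP: (le_total x y) => h; [constructor 2|constructor 3].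
Qed.

Lemma lexlt_cat2l r s t : lexlt le (r ++ s) (r ++ t) = lexlt le s t.
Proof. by elim: r => //= x r ->; rewrite eqxx. Qed.

Lemma lexlt_cat2r s t r : lexlt le s t -> lexlt le (s ++ r) (t ++ r).
Proof.
by elim: s t => [|x s IH] [|y t] //=; case: eqVneq => // _; apply: IH.
Qed.

Lemma wlt_rank u v : wlt le u v -> (rank u < rank v)%N.
Proof.
rewrite /wlt /rank !fdegE => /orP[|/andP[/eqP uv luv]]; last first.
  by rewrite uv ltn_add2l lexlt_code.
move=> uv; apply: (@leq_trans (radix ^ size v)); last exact: leq_addr.
apply: leq_trans (leq_pexp2l (isT : 0 < radix)%N uv).
apply: (@leq_trans (2 * radix ^ size u)).
  by rewrite mul2n -addnn ltn_add2l code_lt.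
by rewrite expnS leq_mul2r orbT.
Qed.

Lemma wlt_total u v : [\/ u = v, wlt le u v | wlt le v u].
Proof.
rewrite /wlt; case: (ltngtP (fdeg u) (fdeg v)) => [||E] /=.
- by constructor 2.
- by constructor 3.
by case: (lexlt_total E) => h;
  [constructor 1; apply: val_inj|constructor 2|constructor 3].
Qed.

(** The order on words is the order of the natural numbers pulled back along
    [rank]; in particular it is well founded. *)
Lemma wltE u v : wlt le u v = (rank u < rank v)%N.
Proof.
apply/idP/idP; first exact: wlt_rank.
by case: (wlt_total u v) => [->|//|/wlt_rank]; rewrite ?ltnn //; case: ltngtP.
Qed.

Lemma rank_inj : injective rank.
Proof.
by move=> u v E; case: (wlt_total u v) => [//||] /wlt_rank; rewrite E ltnn.
Qed.

Lemma rank_mul a u v b :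
  (rank (a ** u ** b) < rank (a ** v ** b))%N = (rank u < rank v)%N.
Proof.
have H u' v' :
    (rank u' < rank v')%N -> (rank (a ** u' ** b) < rank (a ** v' ** b))%N.
  rewrite -!wltE /wlt !fdegM !fmM -!catA => /orP[h|/andP[/eqP -> h]].
    by rewrite ltn_add2r ltn_add2l h.
  by rewrite eqxx lexlt_cat2l lexlt_cat2r // orbT.
apply/idP/idP; last exact: H.
case: (wlt_total u v) => [->||]; rewrite ?ltnn // wltE // => /H.
by case: ltngtP.
Qed.

End DegLex.

(** * Factorizations of words *)

Section Words.
Variable m : nat.
Implicit Types (u v a b : word m).

Lemma mmul_inj a b : injective (fun u => a ** u ** b).
Proof.
move=> u v /(congr1 (@fmonom_val _)); rewrite !fmM -!catA => E.
apply: val_inj => /=; have /eqP := E; rewrite eqseq_cat // eqxx /= => /eqP.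
move/(congr1 rev); rewrite !rev_cat => /eqP.
by rewrite eqseq_cat // eqxx => /eqP/(can_inj revK).
Qed.

Lemma mmul_split u v u' v' : u ** v = u' ** v' -> (fdeg u <= fdeg u')%N ->
  exists2 e, u' = u ** e & v = e ** v'.
Proof.
move=> /(congr1 (@fmonom_val _)); rewrite !fmM => E uu'.
exists (FMonom (drop (fdeg u) u')); apply: val_inj => /=; rewrite fmM /=.
  rewrite -{1}(cat_take_drop (fdeg u) u'); congr (_ ++ _).
  by move/(congr1 (take (fdeg u))): E; rewrite take_size_cat // takel_cat.
move/(congr1 (drop (fdeg u))): E; rewrite drop_size_cat // => ->.
rewrite drop_cat; case: ltnP => // u'u.
have -> : fdeg u = size u' by apply/eqP; rewrite eqn_leq u'u uu'.
by rewrite subnn drop0 drop_size.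
Qed.

Lemma infix_mmul u v a b : v = a ** u ** b -> infix u v.
Proof. by move=> ->; rewrite !fmM -catA; apply/infixP; exists a, b. Qed.

Lemma infix_mmulP u v : infix u v -> exists a b, v = a ** u ** b.
Proof.
move=> /infixP[p [q E]]; exists (FMonom p), (FMonom q).
by apply: val_inj; rewrite /= !fmM -catA.
Qed.

End Words.

(** * Linear algebra in the free algebra *)

(** If [x] is proportional to [y] up to the error [q x - p y], then the
    multiple of [x] can be absorbed into the multiple of [y]. *)
Lemma lincomb_sub_proportional (K : fieldType) (V : lmodType K)
    (c e p q : K) (x y h : V) : q != 0 ->
  c *: x + h - (e + c * p / q) *: y =
  (c / q) *: (q *: x - p *: y) + (h - e *: y).
Proof.
move=> q0; rewrite scalerBr !scalerA divfK // scalerDl (mulrAC c).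
by rewrite opprD (addrC (- (e *: y))) !addrA; congr (_ - _); rewrite addrAC.
Qed.

Section FreeAlgebra.
Variables (C : comNzRingType) (W : monomType).

Local Notation F := {malg C[W]}.
Local Notation "'mon' w" := (<< w >> : F) (at level 10, w at level 8).

Implicit Types (f g h : F) (u v w a b : W) (c : C).

Lemma monZ c w : << c *g w >> = c *: mon w.
Proof. by apply/malgP => k; rewrite mcoeffZ !mcoeffU mulrnAr mulr1. Qed.

Lemma monM u v : mon (u ** v) = mon u * mon v.
Proof. by rewrite malgM_def fgmulUU mulr1. Qed.

Lemma malg_expand f : f = \sum_(w <- msupp f) f@_w *: mon w.
Proof. by rewrite [LHS]monalgE; apply: eq_bigr => w _; rewrite monZ. Qed.

Lemma mulrZ f c g : f * (c *: g) = c *: (f * g).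
Proof.
apply/malgP => k; rewrite mcoeffZ.
rewrite (@mcoeffMlw _ _ (msupp f) (msupp g)) ?msuppZ_le // mcoeffMl big_distrr /=.
apply: eq_bigr => u _; rewrite big_distrr /=; apply: eq_bigr => v _.
by rewrite mcoeffZ mulrnAr mulrCA.
Qed.

Lemma scale_mul f c g : c *: f * g = c *: (f * g).
Proof. by rewrite scalerAl. Qed.

(** In the difference of [d f e y] and [c x e g], the terms [c x] of [f] and
    [d y] of [g] may be removed: their contributions cancel. *)
Lemma mul_sub_tails c d e f g x y :
  d *: (mon mone * f * mon (e ** y)) - c *: (mon (x ** e) * g * mon mone) =
  ((f - c *: mon x) * mon e) * g * mon mone
    - mon mone * f * (mon e * (g - d *: mon y)).
Proof.
rewrite !monM !mul1r !mulr1 !mulrBl !mulrBr !mulrZ !scale_mul !mulrA opprB.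
by rewrite [RHS]addrC addrA addrNK.
Qed.

(** The terms of a sum over the support may be taken over any larger finite
    set, provided that the summand vanishes with the coefficient. *)
Lemma sum_msuppw (V : zmodType) (G : C -> W -> V) (d : {fset W}) f :
  (forall w, G 0 w = 0) -> (msupp f `<=` d)%fset ->
  \sum_(w <- msupp f) G f@_w w = \sum_(w <- d) G f@_w w.
Proof.
by move=> G0 fd; apply: big_fset_incl => // w _ /mcoeff_outdom ->.
Qed.

(** A sum over the support whose summand is additive in the coefficient is
    additive in the element. *)
Lemma sum_msuppD (V : zmodType) (G : C -> W -> V) f g :
  (forall c e w, G (c + e) w = G c w + G e w) ->
  \sum_(w <- msupp (f + g)) G (f + g)@_w w =
  \sum_(w <- msupp f) G f@_w w + \sum_(w <- msupp g) G g@_w w.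
Proof.
move=> GD; have G0 w : G 0 w = 0.
  by apply: (addrI (G 0 w)); rewrite -GD !addr0.
rewrite (sum_msuppw G0 (msuppD_le f g)).
rewrite (sum_msuppw G0 (fsubsetUl (msupp f) (msupp g))).
rewrite (sum_msuppw G0 (fsubsetUr (msupp f) (msupp g))) -big_split /=.
by apply: eq_bigr => w _; rewrite mcoeffD GD.
Qed.

Lemma sum_msuppZ (V : zmodType) (G : C -> W -> V) c f :
  (forall w, G 0 w = 0) ->
  \sum_(w <- msupp (c *: f)) G (c *: f)@_w w = \sum_(w <- msupp f) G (c * f@_w) w.
Proof.
move=> G0; rewrite (sum_msuppw G0 (msuppZ_le c f)).
by apply: eq_bigr => w _; rewrite mcoeffZ.
Qed.

Lemma sum_msuppU (V : zmodType) (G : C -> W -> V) c w :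
  (forall w', G 0 w' = 0) ->
  \sum_(u <- msupp (c *: mon w)) G (c *: mon w)@_u u = G c w.
Proof.
move=> G0; rewrite -monZ (sum_msuppw G0 msuppU_le) big_seq_fset1.
by rewrite mcoeffUU.
Qed.

(** Induction on elements of the free algebra, with the words restricted to
    the support of the element. *)
Lemma malg_ind_supp (P : F -> Prop) f :
  P 0 -> (forall c w g, w \in msupp f -> P g -> P (c *: mon w + g)) -> P f.
Proof.
move=> P0 PD; rewrite [f]malg_expand big_seq.
by elim/big_rec: _ => // w g wf Pg; apply: PD.
Qed.

Lemma malg_ind (P : F -> Prop) :
  P 0 -> (forall c w g, P g -> P (c *: mon w + g)) -> forall f, P f.
Proof. by move=> P0 PD f; apply: malg_ind_supp => // c w g _; apply: PD. Qed.

Lemma mon_mul_mon a f b :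
  mon a * f * mon b = \sum_(w <- msupp f) f@_w *: mon (a ** w ** b).
Proof.
rewrite {1}[f]malg_expand mulr_sumr mulr_suml; apply: eq_bigr => w _.
by rewrite mulrZ scale_mul -!monM.
Qed.

Lemma mcoeff_mon_mul a f b w : injective (fun u => a ** u ** b) ->
  (mon a * f * mon b)@_(a ** w ** b) = f@_w.
Proof.
move=> ab_inj; rewrite mon_mul_mon raddf_sum /=.
under eq_bigr => u _ do rewrite mcoeffZ mcoeffU (inj_eq ab_inj).
rewrite -[RHS](mulr1); case: (boolP (w \in msupp f)) => wf.
  rewrite (big_fsetD1 w) //= eqxx big1_fset ?addr0 // => u.
  by rewrite !inE => /andP[/negPf -> _] _; rewrite mulr0.
rewrite (mcoeff_outdom wf) mul0r big1_fset // => u uf _.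
by case: eqVneq uf wf => [->|_ _ _]; rewrite ?mulr0 // => ->.
Qed.

Lemma msupp_mon_mul a f b w :
  w \in msupp (mon a * f * mon b) ->
  exists2 u, u \in msupp f & w = a ** u ** b.
Proof.
move=> /msuppM_le[w1 [w2 [/msuppM_le[w3 [w4 []]]]]].
by rewrite !msuppU1 !inE => /eqP -> uf -> /eqP -> ->; exists w4.
Qed.

(** A property stable under sums holds for [f s g] as soon as it holds for
    all [c u s v], with [u] and [v] words of [f] and [g]. *)
Lemma mul_ind_supp (P : F -> Prop) f s g :
  P 0 -> (forall f1 f2, P f1 -> P f2 -> P (f1 + f2)) ->
  (forall c u v, u \in msupp f -> v \in msupp g ->
     P (c *: (mon u * s * mon v))) ->
  P (f * s * g).
Proof.
move=> P0 PD Pfg.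
apply: (malg_ind_supp (P := fun f' => P (f' * s * g)) (f := f)).
  by rewrite !mul0r.
move=> c u f' uf IH.
rewrite (mulrDl (c *: mon u) f' s) (mulrDl (c *: mon u * s)).
apply: (PD); last exact: IH.
apply: (malg_ind_supp (P := fun g' => P (c *: mon u * s * g')) (f := g)).
  by rewrite mulr0.
move=> e v g' vg IH'; rewrite mulrDr; apply: (PD); last exact: IH'.
by rewrite mulrZ !scale_mul scalerA; apply: Pfg.
Qed.

Lemma mon_mul_linear a b c f g :
  mon a * (c *: f + g) * mon b = c *: (mon a * f * mon b) + mon a * g * mon b.
Proof. by rewrite mulrDr mulrDl mulrZ scale_mul. Qed.

Lemma mon_mul_mon_mul a a' f b' b :
  mon a * (mon a' * f * mon b') * mon b = mon (a ** a') * f * mon (b' ** b).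
Proof. by rewrite !monM !mulrA. Qed.

Lemma mon_mul_sub u v a b a' b' c d f g :
  mon u * (d *: (mon a * f * mon b) - c *: (mon a' * g * mon b')) * mon v =
  d *: (mon (u ** a) * f * mon (b ** v))
    - c *: (mon (u ** a') * g * mon (b' ** v)).
Proof.
rewrite mulrBr mulrBl; congr (_ - _); rewrite mulrZ scale_mul; congr (_ *: _);
  exact: mon_mul_mon_mul.
Qed.

(** The word [a w b] is rewritten by means of [a f b], where [c] is the
    coefficient of [w] in [f] and [g] replaces the product formed with the
    other terms of [f]. *)
Lemma mon_sub_tail a b w c e f g : e * c = 1 ->
  mon (a ** w ** b) - (- e *: g) =
  e *: (mon a * f * mon b - (mon a * (f - c *: mon w) * mon b - g)).
Proof.
move=> ec; rewrite mulrBr mulrBl mulrZ scale_mul !monM.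
by rewrite opprB addrCA subKr scaleNr opprK scalerDr scalerA ec scale1r addrC.
Qed.

Lemma mul_lincomb (A B : Type) (r : seq A) (q : seq B) (c : A -> C) (d : B -> C)
    (x : A -> W) (y : B -> W) :
  (\sum_(i <- r) c i *: mon (x i)) * (\sum_(j <- q) d j *: mon (y j)) =
  \sum_(i <- r) c i *: (\sum_(j <- q) d j *: mon (x i ** y j)).
Proof.
rewrite mulr_suml; apply: eq_bigr => i _; rewrite scale_mul; congr (_ *: _).
by rewrite mulr_sumr; apply: eq_bigr => j _; rewrite mulrZ -monM.
Qed.

(** An additive map that reverses products of words, and acts on coefficients
    by a multiplicative map, reverses all products. *)
Lemma antimultiplicative (sigma : F -> F) (kappa : C -> C) (omega : W -> W) f g :
  sigma 0 = 0 -> {morph sigma : f1 f2 / f1 + f2} ->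
  (forall c w, sigma (c *: mon w) = kappa c *: mon (omega w)) ->
  {morph kappa : c e / c * e} ->
  (forall u v, omega (u ** v) = omega v ** omega u) ->
  sigma (f * g) = sigma g * sigma f.
Proof.
move=> s0 sD sm kM oM; elim/malg_ind: f => [|c u f IHf].
  by rewrite mul0r s0 mulr0.
rewrite mulrDl !sD mulrDr; congr (_ + _); last exact: IHf.
elim/malg_ind: g {IHf} => [|e v g IHg]; first by rewrite mulr0 s0 mul0r.
rewrite mulrDr !sD mulrDl; congr (_ + _); last exact: IHg.
rewrite mulrZ scale_mul -monM scalerA sm oM monM kM -scalerA !sm.
by rewrite mulrZ scale_mul scalerA mulrC -scalerA.
Qed.

End FreeAlgebra.

(** * The ideal generated by a set *)

Section Ideal.
Variables (R : realType) (m : nat) (S : set (freealg R m)).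
Implicit Types (f g z : freealg R m) (c : R[i]).

Local Notation I := (ideal_gen S).

Lemma ideal_gen_two_sided : two_sided_ideal I.
Proof.
split=> [J [[]] //|f g If Ig J Jh|z f If J Jh|f z If J Jh];
  have [[J0 JD Jl Jr] _] := Jh.
- by apply: JD; [apply: If|apply: Ig].
- by apply: Jl; apply: If.
- by apply: Jr; apply: If.
Qed.

Lemma ideal0 : I 0. Proof. by have [] := ideal_gen_two_sided. Qed.

Lemma idealD f g : I f -> I g -> I (f + g).
Proof. by have [_ + _ _] := ideal_gen_two_sided; apply. Qed.

Lemma idealMl z f : I f -> I (z * f).
Proof. by have [_ _ + _] := ideal_gen_two_sided; apply. Qed.

Lemma idealMr f z : I f -> I (f * z).
Proof. by have [_ _ _] := ideal_gen_two_sided; apply. Qed.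

Lemma sub_ideal f : S f -> I f.
Proof. by move=> Sf J [_]; apply. Qed.

Lemma idealZ c f : I f -> I (c *: f).
Proof. by rewrite -mul_malgC; apply: idealMl. Qed.

Lemma idealB f g : I f -> I g -> I (f - g).
Proof. by move=> If Ig; apply: idealD; rewrite // -scaleN1r; apply: idealZ. Qed.

Lemma idealC f g : I (f - g) -> I (g - f).
Proof.
rewrite -(opprB g f) -scaleN1r => /(idealZ (- 1)).
by rewrite scalerA mulrNN mulr1 scale1r.
Qed.

Lemma ideal_trans f g h : I (f - g) -> I (g - h) -> I (f - h).
Proof. by move=> /idealD fg /fg; rewrite addrA subrK. Qed.

Lemma ideal_congr_mull f g h : I (f - g) -> I (h * f - h * g).
Proof. by move=> fg; rewrite -mulrBr; apply: idealMl. Qed.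

Lemma ideal_congr_mulr f g h : I (f - g) -> I (f * h - g * h).
Proof. by move=> fg; rewrite -mulrBl; apply: idealMr. Qed.

End Ideal.

(** * Normal forms: the composition-diamond lemma *)

Section Reduction.
Variables (R : realType) (m : nat) (le : rel (gen m)).
Hypotheses (le_anti : antisymmetric le) (le_trans : transitive le).
Hypothesis (le_total : total le).

Local Notation F := (freealg R m).
Local Notation W := (word m).
Local Notation "'mon' w" := (<< w >> : F) (at level 10, w at level 8).
Local Notation hat := (hat le).
Local Notation rank := (rank le).

Implicit Types (f g h s t : F) (u v w a b : W) (c : R[i]).

Let wltE := wltE le_anti le_trans le_total.
Let rank_inj := rank_inj le_anti le_trans le_total.
Let rank_mul := rank_mul le_anti le_trans le_total.

Lemma rank_wsup u v : rank (wsup le u v) = maxn (rank u) (rank v).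
Proof. by rewrite /wsup wltE; case: ltngtP. Qed.

(** The initial value of the iterated maximum that defines [hat] is harmless,
    the empty word having the least rank. *)
Lemma hat_supp f : f != 0 -> hat f \in msupp f.
Proof.
move=> f0; have [w wf] : exists w, w \in msupp f.
  by apply/fset0Pn; rewrite msupp_eq0.
have big_in (r : seq W) : let x := \big[wsup le/mone]_(w <- r) w in
    (x = mone \/ x \in r) /\ forall u, u \in r -> (rank u <= rank x)%N.
  elim: r => [|u r [IH1 IH2]] /=; first by rewrite big_nil; split; [left|].
  rewrite big_cons; split=> [|v].
    rewrite /wsup; case: ifP => _; last by right; rewrite inE eqxx.
    by case: IH1 => [->|h]; [left|right; rewrite inE h orbT].
  rewrite inE rank_wsup leq_max => /orP[/eqP ->|/IH2 ->]; rewrite ?leqnn ?orbT //.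
have [[] // h /(_ w wf) lew] := big_in (msupp f).
have /rank_inj wE : rank w = rank mone.
  apply/eqP; rewrite eqn_leq -[in X in X && _]h lew /= /rank fdegE fm1 /=.
  by rewrite addn0 expn0 addn_gt0 expn_gt0.
by rewrite /hat h -wE.
Qed.

Lemma rank_hat f u : u \in msupp f -> (rank u <= rank (hat f))%N.
Proof.
rewrite /hat -[u \in _]/(u \in enum_fset (msupp f)).
elim: (enum_fset (msupp f)) => // v r IH.
rewrite inE big_cons rank_wsup leq_max => /orP[/eqP -> |/IH ->].
  by rewrite leqnn.
by rewrite orbT.
Qed.

Lemma hatE f w :
  w \in msupp f -> (forall u, u \in msupp f -> (rank u <= rank w)%N) ->
  hat f = w.
Proof.
move=> wf wmax; apply: rank_inj; apply/eqP; rewrite eqn_leq rank_hat // andbT.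
by apply/wmax/hat_supp; apply: contraTneq wf => ->; rewrite msupp0.
Qed.

Lemma hat_mul a f b : f != 0 -> hat (mon a * f * mon b) = a ** hat f ** b.
Proof.
move=> f0; apply: hatE.
  rewrite -mcoeff_neq0 mcoeff_mon_mul; last exact: mmul_inj.
  by rewrite mcoeff_neq0 hat_supp.
move=> _ /msupp_mon_mul[u uf ->]; rewrite leqNgt rank_mul -leqNgt.
exact: rank_hat.
Qed.

(** The coefficient of the greatest word of [f]. *)
Definition lead_coeff f : R[i] := f@_(hat f).

(** [f] without the term of its greatest word. *)
Definition tail f : F := f - lead_coeff f *: mon (hat f).

Lemma lead_coeff_neq0 f : f != 0 -> lead_coeff f != 0.
Proof. by move=> f0; rewrite mcoeff_neq0 hat_supp. Qed.

Lemma tail_lt f u : u \in msupp (tail f) -> (rank u < rank (hat f))%N.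
Proof.
rewrite -mcoeff_neq0 mcoeffB mcoeffZ mcoeffU => H.
have uh : u != hat f.
  by apply: contra_neq H => ->; rewrite eqxx mulr1 subrr.
rewrite ltn_neqAle (inj_eq rank_inj) uh; apply: rank_hat.
by rewrite -mcoeff_neq0; move: H; rewrite (eq_sym (hat f)) (negPf uh) mulr0 subr0.
Qed.

Variable S : set F.

(** [lead_span P f] : [f] is a linear combination of elements [a s b] with
    [s] nonzero in [S] whose greatest word [a (hat s) b] satisfies [P]. *)
Inductive lead_span (P : W -> Prop) : F -> Prop :=
| lead_span0 : lead_span P 0
| lead_spanS c a s b f : S s -> s != 0 -> P (a ** hat s ** b) ->
    lead_span P f -> lead_span P (c *: (mon a * s * mon b) + f).

Lemma lead_span1 (P : W -> Prop) c a s b : S s -> s != 0 ->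
  P (a ** hat s ** b) -> lead_span P (c *: (mon a * s * mon b)).
Proof. by move=> *; rewrite -[_ *: _]addr0; do !constructor. Qed.

Lemma lead_span_eq (P : W -> Prop) f g :
  f = g -> lead_span P g -> lead_span P f.
Proof. by move=> ->. Qed.

Lemma lead_spanD (P : W -> Prop) f g :
  lead_span P f -> lead_span P g -> lead_span P (f + g).
Proof.
elim=> [|c a s b h Ss s0 Ps _ IH] Pg; rewrite ?add0r // -addrA.
by constructor; auto.
Qed.

Lemma lead_spanZ (P : W -> Prop) c f : lead_span P f -> lead_span P (c *: f).
Proof.
elim=> [|e a s b h Ss s0 Ps _ IH]; first by rewrite scaler0; constructor.
by rewrite scalerDr scalerA; constructor.
Qed.

Lemma lead_spanB (P : W -> Prop) f g :
  lead_span P f -> lead_span P g -> lead_span P (f - g).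
Proof.
by move=> Pf Pg; apply: lead_spanD; rewrite // -scaleN1r; apply: lead_spanZ.
Qed.

Lemma lead_span_sum (P : W -> Prop) (I : Type) (r : seq I) (G : I -> F) :
  (forall i, lead_span P (G i)) -> lead_span P (\sum_(i <- r) G i).
Proof.
by move=> PG; elim/big_rec: _ => [|i x _ Px]; [constructor|apply: lead_spanD].
Qed.

Lemma lead_spanM (P Q : W -> Prop) a b f :
  (forall w, P w -> Q (a ** w ** b)) ->
  lead_span P f -> lead_span Q (mon a * f * mon b).
Proof.
move=> PQ; elim=> [|c a' s b' h Ss s0 /PQ Ps _ IH].
  by rewrite mulr0 mul0r; constructor.
apply: (lead_span_eq (mon_mul_linear a b c (mon a' * s * mon b') h)).
apply: (lead_span_eq (congr1 (fun x => c *: x + _) (mon_mul_mon_mul a a' s b' b))).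
by apply: lead_spanS IH => //; move: Ps; rewrite !mulmA.
Qed.

Lemma sub_lead_span (P Q : W -> Prop) f :
  (forall w, P w -> Q w) -> lead_span P f -> lead_span Q f.
Proof. by move=> PQ; elim=> *; constructor; auto. Qed.

Lemma lead_span_mul (P : W -> Prop) f s g : S s -> s != 0 ->
  (forall u v, u \in msupp f -> v \in msupp g -> P (u ** hat s ** v)) ->
  lead_span P (f * s * g).
Proof.
move=> Ss s0 Pfg.
apply: mul_ind_supp => [|f1 f2|c u v uf vg]; first by constructor.
  exact: lead_spanD.
by apply: lead_span1; auto.
Qed.

Local Notation below w := (fun v => (rank v < rank w)%N).

Hypothesis S_closed : closed_compositions le S.

(** The cross-multiplied difference of two multiples [a s b] and [a' t b'] of
    elements of [S]; the leading terms cancel if [a (hat s) b] and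
    [a' (hat t) b'] are the same word. *)
Definition spoly a s b a' t b' : F :=
  lead_coeff t *: (mon a * s * mon b) - lead_coeff s *: (mon a' * t * mon b').

(** The words [hat s] and [hat t] stand side by side, with [e] in between:
    then the difference is a combination of the products [u e t] and [s e v],
    with [u] a word of [tail s] and [v] a word of [tail t]. *)
Lemma spoly_disjoint s t e : S s -> S t -> s != 0 -> t != 0 ->
  lead_span (below (hat s ** e ** hat t))
    (spoly mone s (e ** hat t) (hat s ** e) t mone).
Proof.
move=> Ss St s0 t0; apply: (lead_span_eq (mul_sub_tails _ _ _ _ _ _ _)).
apply: lead_spanB; apply: lead_span_mul => // u v.
  move=> /msuppM_le[u' [e' [/tail_lt us]]]; rewrite !msuppU1 !inE.
  move=> /eqP -> -> /eqP ->; rewrite mulm1.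
  by rewrite -!mulmA -[u' ** _]mul1m -[hat s ** _]mul1m !(mulmA mone) rank_mul.
rewrite msuppU1 inE => /eqP -> /msuppM_le[e' [v' [+ /tail_lt vt ->]]].
rewrite msuppU1 inE => /eqP ->; rewrite mul1m !mulmA.
by rewrite -[_ ** v']mulm1 -[_ ** hat t]mulm1 rank_mul.
Qed.

Lemma spoly_mul u v a s b a' t b' :
  mon u * spoly a s b a' t b' * mon v =
  spoly (u ** a) s (b ** v) (u ** a') t (b' ** v).
Proof. exact: mon_mul_sub. Qed.

Lemma spoly_overlap s t w w1 w2 : S s -> S t -> s != 0 -> t != 0 ->
  composes le s t w w1 w2 ->
  lead_span (below w) (spoly mone s w1 w2 t mone).
Proof.
move=> Ss St s0 t0 /(proj2 S_closed _ _ _ _ _ Ss St s0 t0).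
move=> [n [c [a [b [h [hP compE]]]]]].
have -> : spoly mone s w1 w2 t mone = composition le s t w1 w2.
  rewrite /spoly /composition -/(lead_coeff t) -/(lead_coeff s).
  by rewrite mul1r mulr1.
rewrite compE; apply: lead_span_sum => j; have [Sh h0] := hP j.
by rewrite wltE (hat_mul _ _ h0); apply: lead_span1.
Qed.

Lemma spoly_shift w s t x y x' y' u v :
  lead_span (below w) (spoly x s y x' t y') ->
  lead_span (below (u ** w ** v))
    (spoly (u ** x) s (y ** v) (u ** x') t (y' ** v)).
Proof.
move=> H; apply: (lead_span_eq (esym (spoly_mul _ _ _ _ _ _ _ _))).
by apply: lead_spanM H => v'; rewrite rank_mul.
Qed.

Lemma lead_infix_eq s t : S s -> S t -> s != 0 -> t != 0 ->
  infix (hat s) (hat t) -> s = t.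
Proof.
move=> Ss St s0 t0 st; apply: contrapT => /eqP nst.
by have := proj1 S_closed _ _ Ss St s0 t0 nst; rewrite st.
Qed.

Lemma spoly_lt_le s t a b a' b' : S s -> S t -> s != 0 -> t != 0 ->
  a ** hat s ** b = a' ** hat t ** b' -> (fdeg a <= fdeg a')%N ->
  lead_span (below (a ** hat s ** b)) (spoly a s b a' t b').
Proof.
move=> Ss St s0 t0; rewrite -!mulmA => E aa'.
have [e -> {}E] := mmul_split E aa'; case: (leqP (fdeg (hat s)) (fdeg e)).
  (* the two occurrences do not meet *)
  move=> /(mmul_split E)[e' -> ->].
  have := spoly_shift a b' (spoly_disjoint e' Ss St s0 t0).
  by rewrite mulm1 mul1m -!mulmA.
move=> es; have [g sE {}E] := mmul_split (esym E) (ltnW es).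
case: (leqP (fdeg (hat t)) (fdeg g)).
  (* [hat t] lies inside [hat s], hence [s = t] and the occurrences agree *)
  move=> /(mmul_split E)[g' gE b'E].
  have ts : t = s.
    apply: lead_infix_eq => //; apply: (infix_mmul (a := e) (b := g')).
    by rewrite sE gE mulmA.
  have /eqP := congr1 (@fdeg _) sE.
  rewrite gE ts !fdegM addnCA -{1}(addn0 (fdeg _)).
  rewrite eqn_add2l eq_sym addn_eq0 !fdeg_eq0 => /andP[/eqP -> /eqP g'1].
  by rewrite b'E g'1 mulm1 mul1m /spoly subrr; constructor.
move=> gt; have [d tE bE] := mmul_split (esym E) (ltnW gt).
(* a proper overlap of the end of [hat s] with the beginning of [hat t] *)
have d1 : d != mone.
  by apply: contraTneq gt => d1; rewrite tE d1 mulm1 ltnn.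
have e1 : e != mone.
  apply: contraTneq gt => e1; rewrite -leqNgt -(mul1m g) -e1 -sE.
  suff -> : s = t by [].
  apply: lead_infix_eq => //; apply: (infix_mmul (a := mone) (b := d)).
  by rewrite sE e1 !mul1m tE.
have comp : composes le s t (hat s ** d) d e.
  by split; rewrite // tE sE mulmA.
have := spoly_shift a b' (spoly_overlap Ss St s0 t0 comp).
by rewrite mulm1 mul1m bE -!mulmA.
Qed.

Lemma spolyC a s b a' t b' : spoly a' t b' a s b = - spoly a s b a' t b'.
Proof. by rewrite /spoly opprB. Qed.

(** Two multiples of elements of [S] with the same greatest word [w] are
    proportional modulo multiples with smaller greatest words. *)
Lemma spoly_lt s t a b a' b' : S s -> S t -> s != 0 -> t != 0 ->
  a ** hat s ** b = a' ** hat t ** b' ->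
  lead_span (below (a ** hat s ** b)) (spoly a s b a' t b').
Proof.
move=> Ss St s0 t0 E; case/orP: (leq_total (fdeg a) (fdeg a')) => aa'.
  exact: spoly_lt_le.
rewrite E spolyC -scaleN1r; apply: lead_spanZ.
by apply: spoly_lt_le => //; rewrite E.
Qed.

Lemma lead_span_supp w f u :
  lead_span (below w) f -> u \in msupp f -> (rank u < rank w)%N.
Proof.
elim=> [|c a s b h _ s0 asb _ IH]; first by rewrite msupp0.
move=> /(fsubsetP (msuppD_le _ _)); rewrite in_fsetU => /orP[|/IH //].
move=> /(fsubsetP (msuppZ_le _ _)) /rank_hat; rewrite (hat_mul _ _ s0) => h1.
exact: leq_ltn_trans h1 asb.
Qed.

(** Of the multiples of elements of [S] with greatest word [w], at most one
    is needed, the others being proportional to it modulo lower multiples. *)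
Lemma lead_span_top w f : lead_span (fun v => (rank v <= rank w)%N) f ->
  lead_span (below w) f \/
  exists c a s b, [/\ S s, s != 0, a ** hat s ** b = w
                    & lead_span (below w) (f - c *: (mon a * s * mon b))].
Proof.
elim=> [|c a s b h Ss s0]; first by left; constructor.
rewrite leq_eqVlt => /orP[/eqP/rank_inj asb|asb] _ [Ih|[e]].
- right; exists c, a, s, b; split; [exact: Ss|exact: s0|exact: asb|].
  by apply: (lead_span_eq _ Ih); rewrite addrC addKr.
- move=> [a' [t [b' [St t0 a'tb' Ih]]]].
  (* the new multiple with greatest word [w] is merged with the old one *)
  have q0 := lead_coeff_neq0 t0.
  right; exists (e + c * lead_coeff s / lead_coeff t), a', t, b'.
  split; [exact: St|exact: t0|exact: a'tb'|].
  apply: (lead_span_eq (lincomb_sub_proportional _ _ _ _ _ _ q0)).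
  apply: lead_spanD Ih; apply: lead_spanZ; rewrite -asb.
  by apply: spoly_lt; rewrite // a'tb'.
- by left; apply: lead_spanS asb Ih.
- move=> [a' [t [b' [St t0 a'tb' Ih]]]].
  right; exists e, a', t, b'; split; [exact: St|exact: t0|exact: a'tb'|].
  apply: (lead_span_eq (esym (addrA _ _ _))); exact: lead_spanS asb Ih.
Qed.

(** If [f] is in the span of [BW], then its coefficient at a word [w] of the
    form [a (hat s) b] is zero, so the multiple with greatest word [w] can be
    dropped. *)
Lemma lead_span_below_BW n f :
  lead_span (fun v => (rank v < n)%N) f -> spanBW le S f -> f = 0.
Proof.
elim: n f => [|n IH] f Jf Bf; first by case: Jf.
have [[w wn]|nw] := pselect (exists w, rank w = n); last first.
  apply: IH => //; apply: sub_lead_span Jf => v; rewrite ltnS leq_eqVlt.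
  by case/orP=> // /eqP vn; case: nw; exists v.
rewrite -{}wn in Jf IH.
have [/IH|[c]] := lead_span_top Jf; first exact.
move=> [a [s [b [Ss s0 asb Jc]]]].
have [c0|c0] := eqVneq c 0.
  by apply: IH Bf; move: Jc; rewrite c0 scale0r subr0.
have fw : f@_w = c * lead_coeff s.
  have sw := mcoeff_mon_mul s (hat s) (@mmul_inj _ a b).
  rewrite asb in sw; apply/eqP; rewrite -subr_eq0 /lead_coeff -sw.
  rewrite -mcoeffZ -mcoeffB mcoeff_eq0; apply/negP => /(lead_span_supp Jc).
  by rewrite ltnn.
have /Bf/(_ s Ss s0) : w \in msupp f.
  by rewrite -mcoeff_neq0 fw mulf_neq0 // lead_coeff_neq0.
by rewrite (infix_mmul (esym asb)).
Qed.

Lemma lead_span_bounded f : lead_span (fun=> True) f ->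
  exists n, lead_span (fun v => (rank v < n)%N) f.
Proof.
elim=> [|c a s b h Ss s0 _ _ [n IH]]; first by exists 0%N; constructor.
exists (maxn n (rank (a ** hat s ** b)).+1); constructor; rewrite // ?leq_maxr //.
by apply: sub_lead_span IH => v vn; rewrite leq_max vn.
Qed.

Lemma lead_span_mull z f :
  lead_span (fun=> True) f -> lead_span (fun=> True) (z * f).
Proof.
move=> Jf; elim/malg_ind: z => [|c w z IH]; first by rewrite mul0r; constructor.
apply: (lead_span_eq (mulrDl (c *: mon w) z f)); apply: lead_spanD IH.
rewrite scale_mul -[_ * f]mulr1; apply: lead_spanZ.
exact: (lead_spanM (b := mone)) Jf.
Qed.

Lemma lead_span_mulr z f :
  lead_span (fun=> True) f -> lead_span (fun=> True) (f * z).
Proof.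
move=> Jf; elim/malg_ind: z => [|c w z IH]; first by rewrite mulr0; constructor.
rewrite mulrDr; apply: lead_spanD IH.
rewrite mulrZ -[f]mul1r; apply: lead_spanZ.
exact: (lead_spanM (a := mone)) Jf.
Qed.

Lemma ideal_lead_span f : ideal_gen S f -> lead_span (fun=> True) f.
Proof.
apply; split; first split.
- by constructor.
- by move=> g h; apply: lead_spanD.
- by move=> z g; apply: lead_span_mull.
- by move=> g z; apply: lead_span_mulr.
move=> s Ss; have [->|s0] := eqVneq s 0; first by constructor.
rewrite -[s]mul1r -[1 * s]mulr1 -[_ * _]scale1r.
exact: (lead_span1 _ (a := mone) (b := mone)).
Qed.

(** Composition-diamond lemma: the span of [BW] meets the ideal trivially. *)
Lemma ideal_spanBW_eq0 f : ideal_gen S f -> spanBW le S f -> f = 0.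
Proof.
by move=> /ideal_lead_span/lead_span_bounded[n]; apply: lead_span_below_BW.
Qed.

Lemma spanBW0 : spanBW le S 0.
Proof. by move=> w; rewrite msupp0. Qed.

Lemma spanBWD f g : spanBW le S f -> spanBW le S g -> spanBW le S (f + g).
Proof.
move=> Kf Kg w /(fsubsetP (msuppD_le f g)); rewrite in_fsetU.
by case/orP; [apply: Kf|apply: Kg].
Qed.

Lemma spanBWZ c f : spanBW le S f -> spanBW le S (c *: f).
Proof. by move=> Kf w /(fsubsetP (msuppZ_le c f)); apply: Kf. Qed.

Lemma spanBW_mon w : BW le S w -> spanBW le S (mon w).
Proof. by move=> Bw v; rewrite msuppU1 in_fset1 => /eqP ->. Qed.

(** [k] is a normal form of [f] modulo the ideal generated by [S]. *)
Definition normal_form f k : Prop :=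
  spanBW le S k /\ ideal_gen S (f - k).

Lemma normal_form_lincomb c f g k l :
  normal_form f k -> normal_form g l -> normal_form (c *: f + g) (c *: k + l).
Proof.
move=> [Kk fk] [Kl gl]; split; first by apply: spanBWD; [apply: spanBWZ|].
by rewrite opprD addrACA -scalerBr; apply: idealD; [apply: idealZ|].
Qed.

Lemma normal_form_mon w : exists k, normal_form (mon w) k.
Proof.
have [n] := ubnP (rank w); elim: n w => // n IH w; rewrite ltnS => wn.
have [Bw|] := pselect (BW le S w).
  by exists (mon w); split; [apply: spanBW_mon|rewrite subrr; apply: ideal0].
move=> /existsNP[s /not_implyP[Ss /not_implyP[s0 /negP]]]; rewrite negbK.
move=> /infix_mmulP[a [b wE]].
have [k [Kk Tk]] : exists k, normal_form (mon a * tail s * mon b) k.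
  apply: (malg_ind_supp (P := fun T => exists k, normal_form T k)).
    by exists 0; split; [exact: spanBW0|rewrite subrr; apply: ideal0].
  move=> c v g /msupp_mon_mul[u /tail_lt us vE] [l gl].
  have [|k vk] := IH v; last by exists (c *: k + l); apply: normal_form_lincomb.
  by apply: leq_trans wn; rewrite vE wE rank_mul.
have p0 := lead_coeff_neq0 s0; set p := lead_coeff s in p0.
exists (- p^-1 *: k); split; first exact: spanBWZ.
rewrite wE (mon_sub_tail _ _ _ s _ (mulVf p0)); apply: idealZ.
apply: idealB; last exact: Tk.
by apply: idealMr; apply: idealMl; apply: sub_ideal.
Qed.

Lemma normal_form_exists f : exists k, normal_form f k.
Proof.
elim/malg_ind: f => [|c w f [k fk]].
  by exists 0; split; [exact: spanBW0|rewrite subrr; apply: ideal0].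
have [l wl] := normal_form_mon w.
by exists (c *: l + k); apply: normal_form_lincomb.
Qed.

Lemma spanBW_reduce f : spanBW le S (reduce le S f).
Proof.
by have [k fk] := normal_form_exists f; have [] := xgetPex 0 (ex_intro _ k fk).
Qed.

Lemma reduce_congr f : ideal_gen S (f - reduce le S f).
Proof.
by have [k fk] := normal_form_exists f; have [] := xgetPex 0 (ex_intro _ k fk).
Qed.

Lemma reduce_unique f k :
  spanBW le S k -> ideal_gen S (f - k) -> reduce le S f = k.
Proof.
move=> Kk fk; apply/eqP; rewrite -subr_eq0; apply/eqP/ideal_spanBW_eq0.
  by apply: ideal_trans fk; apply: idealC; apply: reduce_congr.
apply: spanBWD; first exact: spanBW_reduce.
by rewrite -scaleN1r; apply: spanBWZ.
Qed.

Lemma reduce_id f : spanBW le S f -> reduce le S f = f.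
Proof. by move=> Kf; apply: reduce_unique; rewrite // subrr; apply: ideal0. Qed.

Lemma reduce_eq f g : ideal_gen S (f - g) -> reduce le S f = reduce le S g.
Proof.
move=> fg; apply: reduce_unique; first exact: spanBW_reduce.
exact: ideal_trans fg (reduce_congr g).
Qed.

Lemma reduce_lincomb c f g :
  reduce le S (c *: f + g) = c *: reduce le S f + reduce le S g.
Proof.
have [] : normal_form (c *: f + g) (c *: reduce le S f + reduce le S g).
  by apply: normal_form_lincomb; split;
    by [apply: spanBW_reduce|apply: reduce_congr].
exact: reduce_unique.
Qed.

End Reduction.

(** * The involution and the maps H and T *)

Section Involution.
Variables (R : realType) (m : nat).

Local Notation F := (freealg R m).
Local Notation W := (word m).
Local Notation "'mon' w" := (<< w >> : F) (at level 10, w at level 8).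

Implicit Types (f g : F) (u v w : W) (c : R[i]).

Lemma wstarK : involutive (@wstar m).
Proof.
move=> w; apply: val_inj; rewrite /= map_rev revK -map_comp map_id_in //.
by move=> [i b] _; rewrite /gstar /= negbK.
Qed.

Lemma wstarM u v : wstar (u ** v) = wstar v ** wstar u.
Proof. by apply: val_inj; rewrite /= !fmM map_cat rev_cat. Qed.

Lemma fdeg_wstar w : fdeg (wstar w) = fdeg w.
Proof. by rewrite !fdegE /= size_rev size_map. Qed.

Let star_term c w : F := << conjc c *g wstar w >>.

Let star_term0 w : star_term 0 w = 0.
Proof. by rewrite /star_term conjc0 monalgU0. Qed.

Lemma star_mon c w : star (c *: mon w) = conjc c *: mon (wstar w).
Proof. by rewrite /star (sum_msuppU (G := star_term)) // /star_term monZ. Qed.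

Lemma starD f g : star (f + g) = star f + star g.
Proof.
apply: (sum_msuppD (G := star_term)) => c e w.
by rewrite /star_term raddfD /= monalgUD.
Qed.

Lemma star0 : star (0 : F) = 0.
Proof. by rewrite /star msupp0 big_seq_fset0. Qed.

Lemma starZ c f : star (c *: f) = conjc c *: star f.
Proof.
rewrite /star (sum_msuppZ (G := star_term)) // scaler_sumr.
apply: eq_bigr => w _; apply/malgP => k.
by rewrite mcoeffZ !mcoeffU mulrnAr (rmorphM (@conjc R)).
Qed.

Lemma starB f g : star (f - g) = star f - star g.
Proof. by rewrite starD -scaleN1r starZ rmorphN rmorph1 scaleN1r. Qed.

Lemma starK : involutive (@star R m).
Proof.
move=> f; elim/malg_ind: f => [|c w f IH]; first by rewrite !star0.
by rewrite starD star_mon starD star_mon IH conjcK wstarK.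
Qed.

Lemma starM f g : star (f * g) = star g * star f.
Proof.
apply: (antimultiplicative (kappa := @conjc R)); first exact: star0.
- exact: starD.
- exact: star_mon.
- exact: rmorphM.
- exact: wstarM.
Qed.

Lemma mul_star_expand f g : f * star g =
  \sum_(u <- msupp f) f@_u *:
    (\sum_(v <- msupp g) conjc g@_v *: mon (u ** wstar v)).
Proof.
rewrite -mul_lincomb -malg_expand; congr (_ * _).
by apply: eq_bigr => w _; exact: monZ.
Qed.

Lemma Hmap_lincomb c f g : Hmap (c *: f + g) = c *: Hmap f + Hmap g.
Proof.
rewrite /Hmap (sum_msuppD (G := fun c w => c *: Hword R w)); last first.
  by move=> *; rewrite scalerDl.
congr (_ + _); rewrite (sum_msuppZ (G := fun c w => c *: Hword R w)).
  by rewrite scaler_sumr; apply: eq_bigr => w _; rewrite scalerA.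
by move=> w; rewrite scale0r.
Qed.

Lemma Hmap_square u : Hmap (mon (u ** wstar u)) = mon u.
Proof.
rewrite /Hmap msuppU1 big_seq_fset1 mcoeffUU scale1r /Hword.
have -> : FMonom (take (fdeg (u ** wstar u))./2 (u ** wstar u)) = u.
  apply: val_inj; rewrite /= fdegM fdeg_wstar addnn doubleK fmM.
  exact: take_size_cat.
by rewrite eqxx.
Qed.

Lemma Tfun_lincomb phi (xi : nat -> R) c f g :
  Tfun phi xi (c *: f + g) = c * Tfun phi xi f + Tfun phi xi g.
Proof.
rewrite /Tfun (sum_msuppD (G := fun c u => c * (xi (phi u))%:C%C)); last first.
  by move=> *; rewrite mulrDl.
congr (_ + _); rewrite (sum_msuppZ (G := fun c u => c * (xi (phi u))%:C%C)).
  by rewrite mulr_sumr; apply: eq_bigr => w _; rewrite mulrA.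
by move=> w; rewrite mul0r.
Qed.

Lemma Tfun_mon phi (xi : nat -> R) u :
  Tfun phi xi (mon u) = (xi (phi u))%:C%C.
Proof. by rewrite /Tfun msuppU1 big_seq_fset1 mcoeffUU mul1r. Qed.

End Involution.

(** * The form and the right regular representation *)

Section Representation.
Variables (R : realType) (m : nat) (le : rel (gen m)).
Hypotheses (le_anti : antisymmetric le) (le_trans : transitive le).
Hypothesis (le_total : total le).
Variables (S : set (freealg R m)) (phi : word m -> nat) (xi : nat -> R).
Hypothesis S_closed : closed_compositions le S.

Local Notation F := (freealg R m).
Local Notation "'mon' w" := (<< w >> : F) (at level 10, w at level 8).
Local Notation I := (ideal_gen S).
Local Notation K := (spanBW le S).
Local Notation red := (reduce le S).

Implicit Types (f g z : F) (u v w : word m) (c : R[i]).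

Let reduceK f : K (red f) := @spanBW_reduce _ _ _ le_anti le_trans le_total S f.
Let reduceI f : I (f - red f) := reduce_congr le_anti le_trans le_total (S := S) f.
Let reduce_eq f g : I (f - g) -> red f = red g :=
  @reduce_eq _ _ _ le_anti le_trans le_total S S_closed f g.
Let reduce_lincomb c f g : red (c *: f + g) = c *: red f + red g :=
  @reduce_lincomb _ _ _ le_anti le_trans le_total S S_closed c f g.
Let reduce_id f : K f -> red f = f :=
  @reduce_id _ _ _ le_anti le_trans le_total S S_closed f.

(** The linear functional [tau] with [<f, g> = tau (f g')] on the
    span of [BW], where [g'] is the adjoint of [g]. *)
Definition form_fun f : R[i] := Tfun phi xi (Hmap (red f)).

Lemma form_fun_lincomb c f g : form_fun (c *: f + g) = c * form_fun f + form_fun g.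
Proof. by rewrite /form_fun reduce_lincomb Hmap_lincomb Tfun_lincomb. Qed.

Lemma form_fun_eq f g : I (f - g) -> form_fun f = form_fun g.
Proof. by move=> /reduce_eq fg; rewrite /form_fun fg. Qed.

Lemma form_fun0 : form_fun 0 = 0.
Proof.
have := form_fun_lincomb (-1) 0 0; rewrite scaler0 addr0 mulN1r addNr.
exact.
Qed.

Lemma form_fun_sum (A : Type) (r : seq A) (c : A -> R[i]) (G : A -> F) :
  form_fun (\sum_(i <- r) c i *: G i) = \sum_(i <- r) c i * form_fun (G i).
Proof.
elim: r => [|i r IH]; first by rewrite !big_nil form_fun0.
by rewrite !big_cons form_fun_lincomb IH.
Qed.

Lemma form_fun_mul f g :
  form_fun (f * star g) =
  \sum_(u <- msupp f) \sum_(v <- msupp g)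
    f@_u * conjc g@_v * form_fun (mon (u ** wstar v)).
Proof.
rewrite mul_star_expand form_fun_sum; apply: eq_bigr => u _.
rewrite form_fun_sum mulr_sumr; apply: eq_bigr => v _; exact: mulrA.
Qed.

Hypothesis BW_square : forall d, BW le S d -> BW le S (d ** wstar d).

(** For [u = v] this is where strictness enters: [u] times its adjoint is in
    normal form. *)
Lemma formxi_wordE u v : BW le S u ->
  formxi_word le S phi xi u v = form_fun (mon (u ** wstar v)).
Proof.
rewrite /formxi_word; case: eqVneq => [<- Bu|//].
rewrite /form_fun (reduce_id (spanBW_mon (BW_square Bu))).
by rewrite Hmap_square Tfun_mon.
Qed.

Lemma formxiE f g : K f -> formxi le S phi xi f g = form_fun (f * star g).
Proof.
move=> Kf; rewrite form_fun_mul /formxi big_seq [RHS]big_seq.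
apply: eq_bigr => u /Kf Bu; apply: eq_bigr => v _.
by rewrite formxi_wordE.
Qed.

Hypothesis S_symmetric : symmetric_set S.

Lemma star_congr f g : I (f - g) -> I (star f - star g).
Proof. by move=> /S_symmetric; rewrite starB. Qed.

Lemma formxi_adjoint z f g : K f -> K g ->
  formxi le S phi xi (right_regular le S z f) g =
  formxi le S phi xi f (right_regular le S (quot_star le S z) g).
Proof.
move=> Kf Kg; rewrite (formxiE _ (@reduceK _)) (formxiE _ Kf); apply: form_fun_eq.
apply: (ideal_trans (g := f * z * star g)).
  by apply: ideal_congr_mulr; apply: idealC.
rewrite -mulrA; apply: ideal_congr_mull.
rewrite -[z in z * _]starK -starM; apply: star_congr.
apply: (ideal_trans (g := g * red (star z))); last exact: reduceI.
by apply: ideal_congr_mull; apply: reduceI.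
Qed.

Lemma faithful_right_regular : faithful le S (right_regular le S).
Proof.
move=> z Kz Lz; apply/eqP/negPn/negP => z0.
have Bw := Kz _ (hat_supp le_anti le_trans le_total z0).
(* [BW] is closed under subwords and nonempty, so it contains the empty word *)
have B1 : BW le S mone.
  move=> s Ss s0; apply: contra (Bw s Ss s0).
  by rewrite fm1 infixs0 => /eqP ->; apply: infix0s.
have := Lz _ (spanBW_mon B1); rewrite /right_regular /diamond mul1r reduce_id //.
by move/eqP; apply/negP.
Qed.

Lemma star_representation_right_regular :
  star_representation le S (formxi le S phi xi) (right_regular le S).
Proof.
split.
- by move=> z f _ _; apply: reduceK.
- move=> z _ c f g _ _; rewrite /right_regular /diamond mulrDl scale_mul.
  exact: reduce_lincomb.
- move=> c y z f _ _ _; rewrite /right_regular /diamond mulrDr mulrZ.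
  exact: reduce_lincomb.
- move=> z y f _ _ _; apply: reduce_eq.
  apply: (ideal_trans (g := f * (z * y))).
    by apply: ideal_congr_mull; apply: idealC; apply: reduceI.
  by rewrite mulrA; apply: ideal_congr_mulr; apply: reduceI.
- by move=> z f g _ Kf Kg; apply: formxi_adjoint.
Qed.

End Representation.

Theorem theorem2 (R : realType) (m : nat) (le : rel (gen m))
    (le_refl : reflexive le) (le_anti : antisymmetric le)
    (le_trans : transitive le) (le_total : total le)
    (S : set (freealg R m)) (hS : strictly_nonexpanding le S)
    (phi : word m -> nat) (hphi : enumeration le S phi)
    (xi : nat -> R) (hxi : forall k, (1 <= k)%N -> 0 < xi k)
    (hpos : positive_definite le S (formxi le S phi xi)) :
  star_representation le S (formxi le S phi xi) (right_regular le S) /\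
  faithful le S (right_regular le S).
Proof.
have [[S_symmetric S_closed _] BW_square] := hS; split.
  exact: star_representation_right_regular.
exact: faithful_right_regular.
Qed.
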